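(* Let $\Xi=(a,a_2,v_1,v_2,q,c,v,\alpha,\nu)$ be algebraic data defining a $6$-dimensional strongly unimodular Hermitian almost nilpotent Lie algebra $(\mu(\Xi),J,g)$ as described in the context. Then $(\mu(\Xi),J,g)$ is SKT if and only if either $$a_2=-a,\quad c\neq0,\quad v_1=\tfrac1c\|\alpha\|^2,\quad v=-\tfrac1c\left(A^t+a\,\mathrm{Id}_{\mathfrak{k}_3}\right)(\alpha^\sharp),\quad \nu=-J\alpha,$$ or $$a_2=-a\neq0,\quad c=0,\quad \alpha=\nu=0.$$
   Context: On $\mathbb{R}^6$ with standard basis $\{e_1,\dots,e_6\}$, let $g$ be the standard inner product, $Je_1=e_2$, $Je_3=e_4$, $Je_5=e_6$, $\mathfrak{k}_3=\mathbb{R}\langle e_3,e_4\rangle$. On 1-forms, $J\alpha=-\alpha\circ J$ (so $Je^3=e^4$). Data: $a,a_2,v_1,v_2,q,c\in\mathbb{R}$, $v\in\mathfrak{k}_3$, $\alpha,\nu\in\mathfrak{k}_3^*$. Let $A\in\mathfrak{gl}(\mathfrak{k}_3)$ be given by $Ae_3=-\tfrac12(a+a_2)e_3-qe_4$, $Ae_4=qe_3-\tfrac12(a+a_2)e_4$, and let $\eta=c\,e^{34}+\nu\wedge e^5+a_2\,e^{25}$, assumed nonzero. The bracket $\mu(\Xi)$ is: $[X,Y]=-\eta(X,Y)e_1$ for $X,Y\in\mathfrak{n}=\mathbb{R}\langle e_1,\dots,e_5\rangle$, and $[e_6,X]=BX$ for $X\in\mathfrak n$, where $Be_1=0$, $Be_2=a_2e_2$,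 $BX=\alpha(X)e_1+(J\alpha+\nu)(X)e_2+AX$ for $X\in\mathfrak{k}_3$, $Be_5=v_1e_1+v_2e_2+v+ae_5$. The Jacobi identity is equivalent to the following conditions, which are assumed: $a_2(a+a_2)=0$, $c\,A^*e^{34}=0$, $(a+a_2)\nu+a_2J\alpha+A^*\nu-c\,Jv^\flat=0$, where $A^*$ acts on 1-forms by $A^*\nu=\nu\circ A$ and on 2-forms by $(A^*\sigma)(X,Y)=\sigma(AX,Y)+\sigma(X,AY)$. It is also assumed that $\mathfrak{n}$ is the nilradical of $\mu(\Xi)$ (i.e. $B$ is not nilpotent). $J$ is then integrable and $\mu(\Xi)$ is strongly unimodular (the trace of the action of every element on $\mathfrak{n}/[\mathfrak{n},\mathfrak{n}]$ and on $[\mathfrak{n},\mathfrak{n}]=\mathbb{R}e_1$ vanishes). $A^t$ is the $g$-transpose, $\flat,\sharp$ are the musical isomorphisms of $g$. SKT means $dd^c\omega=0$, with $\omega=g(J\cdot,\cdot)$, $d$ the Chevalley–Eilenberg differential, $d^c=i(\overline\partial-\partial)$. *)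

(* Defs.v *)
From HB Require Import structures.
From mathcomp Require Import all_boot all_order all_algebra.
From mathcomp Require Import complex reals.

Set Implicit Arguments.
Unset Strict Implicit.
Unset Printing Implicit Defensive.

Import Order.TTheory GRing.Theory Num.Theory.
Local Open Scope ring_scope.

(** Vectors are columns and covectors are rows, so that an endomorphism [M]
    acts by [X |-> M *m X], pulls back covectors by [al |-> al *m M], and both
    musical isomorphisms of the standard inner product are transposition. *)

(** * R^6 with its standard Hermitian structure *)

Section Standard.
Variable K : nzRingType.

(* [e k] and [x k] are e_k and e^k, with the 1-based numbering k = 1, ..., 6. *)
Definition e (k : nat) : 'cV[K]_6 := delta_mx (inord k.-1) 0.
Definition x (k : nat) (X : 'cV[K]_6) : K := X (inord k.-1) 0.

Definition J (X : 'cV[K]_6) : 'cV[K]_6 :=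
  x 1 X *: e 2 - x 2 X *: e 1
  + (x 3 X *: e 4 - x 4 X *: e 3)
  + (x 5 X *: e 6 - x 6 X *: e 5).

(* Over R this is the inner product g; over C it is its bilinear (not
   sesquilinear) extension. *)
Definition g (X Y : 'cV[K]_6) : K := (X^T *m Y) 0 0.

Definition in_n (X : 'cV[K]_6) : Prop := x 6 X = 0.

Definition wedge (f h : 'cV[K]_6 -> K) (X Y : 'cV[K]_6) : K :=
  f X * h Y - f Y * h X.

(** ** The plane k_3 = <e_3, e_4>, in the coordinates of (e_3, e_4) *)

Definition E3 : 'cV[K]_2 := delta_mx 0 0.
Definition E4 : 'cV[K]_2 := delta_mx 1 0.
Definition k3_inj (w : 'cV[K]_2) : 'cV[K]_6 := w 0 0 *: e 3 + w 1 0 *: e 4.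
Definition k3_proj (X : 'cV[K]_6) : 'cV[K]_2 := x 3 X *: E3 + x 4 X *: E4.

Definition ev (al : 'rV[K]_2) (w : 'cV[K]_2) : K := (al *m w) 0 0.

Definition J3 : 'M[K]_2 := row_mx E4 (- E3) : 'M_(2, 1 + 1).

(* J on 1-forms: J alpha = - alpha o J. *)
Definition Jform (al : 'rV[K]_2) : 'rV[K]_2 := - (al *m J3).

Definition e34 (w z : 'cV[K]_2) : K := w 0 0 * z 1 0 - z 0 0 * w 1 0.

(* The action A^* on 1-forms and on 2-forms of k_3. *)
Definition pull1 (A : 'M[K]_2) (nu : 'rV[K]_2) : 'rV[K]_2 := nu *m A.
Definition pull2 (A : 'M[K]_2) (s : 'cV[K]_2 -> 'cV[K]_2 -> K)
    (w z : 'cV[K]_2) : K := s (A *m w) z + s w (A *m z).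

Definition flat (w : 'cV[K]_2) : 'rV[K]_2 := w^T.
Definition sharp (al : 'rV[K]_2) : 'cV[K]_2 := al^T.
Definition normsq (al : 'rV[K]_2) : K := (al *m al^T) 0 0.

End Standard.

(** * The algebraic data and the bracket they define *)

Record data (R : realType) := Data {
  a_ : R; a2_ : R; v1_ : R; v2_ : R; q_ : R; c_ : R;
  v_ : 'cV[R]_2; alpha_ : 'rV[R]_2; nu_ : 'rV[R]_2 }.

Section Bracket.
Variables (R : realType) (Xi : data R).
Local Notation V := 'cV[R]_6.
Local Notation a := (a_ Xi).
Local Notation a2 := (a2_ Xi).
Local Notation c := (c_ Xi).
Local Notation alpha := (alpha_ Xi).
Local Notation nu := (nu_ Xi).

(* The two columns are A e_3 and A e_4. *)
Definition Amx : 'M[R]_2 :=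
  row_mx (- (2^-1 * (a + a2)) *: E3 R - q_ Xi *: E4 R)
         (q_ Xi *: E3 R - (2^-1 * (a + a2)) *: E4 R) : 'M_(2, 1 + 1).

(* [eta] and [B] live on n = <e_1, ..., e_5>; they are extended by zero along
   e_6. *)
Definition eta (X Y : V) : R :=
  c * wedge (@x R 3) (@x R 4) X Y
  + wedge (fun Z => ev nu (k3_proj Z)) (@x R 5) X Y
  + a2 * wedge (@x R 2) (@x R 5) X Y.

Definition B (X : V) : V :=
  let w := k3_proj X in
  x 2 X *: (a2 *: e R 2)
  + (ev alpha w *: e R 1 + ev (Jform alpha + nu) w *: e R 2
     + k3_inj (Amx *m w))
  + x 5 X *: (v1_ Xi *: e R 1 + v2_ Xi *: e R 2 + k3_inj (v_ Xi) + a *: e R 5).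

Definition bracket (X Y : V) : V :=
  - eta X Y *: e R 1 + (x 6 X *: B Y - x 6 Y *: B X).

(* [jacobi1], [jacobi2], [jacobi3] together are the Jacobi identity for
   [bracket]; [B_not_nilpotent] says that n is its nilradical. *)
Record admissible : Prop := Admissible {
  eta_neq0 : exists X Y : V, [/\ in_n X, in_n Y & eta X Y != 0];
  jacobi1 : a2 * (a + a2) = 0;
  jacobi2 : forall w z : 'cV[R]_2, c * pull2 Amx (@e34 R) w z = 0;
  jacobi3 : (a + a2) *: nu + a2 *: Jform alpha + pull1 Amx nu
            - c *: Jform (flat (v_ Xi)) = 0;
  B_not_nilpotent :
    ~ (exists k : nat, forall X : V, in_n X -> iter k B X = 0) }.

End Bracket.

(** * Complex forms, Dolbeault operators and the SKT condition *)

(** Complex k-forms on a real Lie algebra are represented as functions of k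
    vectors of its complexification C^6; all operators below are meant for (and
    preserve) alternating multilinear functions. *)

Section Forms.
Variable R : realType.
Local Notation C := R[i].
Local Notation VC := 'cV[C]_6.

Definition form (k : nat) := ('I_k -> VC) -> C.

Definition vcons (k : nat) (X0 : VC) (X : 'I_k -> VC) : 'I_k.+1 -> VC :=
  fun m => if unlift ord0 m is Some m' then X m' else X0.

(* C-bilinear extension of a bracket of R^6. *)
Definition complexify (br : 'cV[R]_6 -> 'cV[R]_6 -> 'cV[R]_6) (X Y : VC) : VC :=
  \sum_(i < 6) \sum_(j < 6) (X i 0 * Y j 0) *:
    map_mx (real_complex R) (br (delta_mx i 0) (delta_mx j 0)).

(* d s (X_0, ..., X_k) =
     \sum_(i < j) (-1)^(i+j) s ([X_i, X_j], X_0, ..^i ..^j .., X_k),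
   where the indices j > i are enumerated as j = lift i m with i <= m. *)
Definition CEd (br : 'cV[R]_6 -> 'cV[R]_6 -> 'cV[R]_6) (k : nat)
    (s : form k.+1) : form k.+2 := fun X =>
  \sum_(i < k.+2) \sum_(m < k.+1 | (i <= m)%N)
    (-1) ^+ (i + lift i m)%N *
    s (vcons (complexify br (X i) (X (lift i m)))
             (fun l : 'I_k => X (lift i (lift m l)))).

(* Components of type (1,0) and (0,1) of a complex vector. *)
Definition proj10 (X : VC) : VC := 2^-1 *: (X - 'i%C *: J X).
Definition proj01 (X : VC) : VC := 2^-1 *: (X + 'i%C *: J X).

(* Component of type (p, k - p) of a k-form. *)
Definition type_part (k p : nat) (s : form k) : form k := fun X =>
  \sum_(S : {set 'I_k} | #|S| == p)
    s (fun l => if l \in S then proj10 (X l) else proj01 (X l)).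

Variable br : 'cV[R]_6 -> 'cV[R]_6 -> 'cV[R]_6.

(* On forms of type (p, q), [del] is the (p + 1, q) part of d and [delbar] its
   (p, q + 1) part. *)
Definition del (k : nat) (s : form k.+1) : form k.+2 := fun X =>
  \sum_(p < k.+2) type_part p.+1 (CEd br (type_part p s)) X.
Definition delbar (k : nat) (s : form k.+1) : form k.+2 := fun X =>
  \sum_(p < k.+2) type_part p (CEd br (type_part p s)) X.

Definition dc (k : nat) (s : form k.+1) : form k.+2 := fun X =>
  'i%C * (delbar s X - del s X).

Definition omega : form 2 := fun X => g (J (X 0)) (X 1).

Definition SKT : Prop := forall X : 'I_4 -> VC, CEd br (dc omega) X = 0.

End Forms.

(* Main.v *)
Require Import Defs.
From HB Require Import structures.
From mathcomp Require Import all_boot all_order all_algebra.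
From mathcomp Require Import complex reals ring lra zify.

Set Implicit Arguments.
Unset Strict Implicit.
Unset Printing Implicit Defensive.

Import Order.TTheory GRing.Theory Num.Theory.
Local Open Scope ring_scope.

(* The 4-form dd^c omega has only seven components that do not vanish
   identically, along e^{1256}, e^{1346}, e^{1356}, e^{1456}, e^{2356},
   e^{2456} and e^{3456}, so SKT is a system of seven polynomial equations in
   the data.  Put m = -(a + a_2)/2 and rho = nu + J alpha.  The equations along
   e^{2356} and e^{2456} form a linear system for rho with determinant
   (m - a_2)^2 + q^2.  If it vanishes, the Jacobi identity a_2 (a + a_2) = 0
   forces a = a_2 = q = 0, and then B is nilpotent; hence rho = 0.  With
   nu = - J alpha, the remaining equations determine v and v_1 when c <> 0, and
   give |alpha|^2 = 0 when c = 0. *)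

(** * Coordinate expansions of d omega, d^c omega and d d^c omega *)

Section Coordinates.
Variable K : comNzRingType.
Implicit Types X Y Z : 'cV[K]_6.

Lemma xD k X Y : x k (X + Y) = x k X + x k Y.
Proof. by rewrite /x mxE. Qed.

Lemma xN k X : x k (- X) = - x k X.
Proof. by rewrite /x mxE. Qed.

Lemma xZ k r X : x k (r *: X) = r * x k X.
Proof. by rewrite /x mxE. Qed.

Lemma x_sum k (I : Type) (s : seq I) (P : pred I) (F : I -> 'cV[K]_6) :
  x k (\sum_(i <- s | P i) F i) = \sum_(i <- s | P i) x k (F i).
Proof. by rewrite /x summxE. Qed.

Lemma x_e k l : (k.-1 < 6)%N -> (l.-1 < 6)%N ->
  x k (e K l) = (k.-1 == l.-1)%:R.
Proof. by move=> hk hl; rewrite /x /e mxE -val_eqE /= !inordK // andbT. Qed.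

Lemma sum6 (V : nmodType) (F : 'I_6 -> V) : \sum_(i < 6) F i =
  F (inord 0) + F (inord 1) + F (inord 2) + F (inord 3) + F (inord 4)
  + F (inord 5).
Proof.
rewrite (eq_bigr (fun i : 'I_6 => F (inord i))) => [|i _]; last first.
  by rewrite inord_val.
by rewrite -(big_mkord xpredT (fun i => F (inord i))) unlock /= addr0 !addrA.
Qed.

Definition xE := (xD, xN, xZ).

Lemma xJ X : (x 1 (J X) = - x 2 X) * (x 2 (J X) = x 1 X) *
  (x 3 (J X) = - x 4 X) * (x 4 (J X) = x 3 X) *
  (x 5 (J X) = - x 6 X) * (x 6 (J X) = x 5 X).
Proof. by repeat split; rewrite /J !xE !x_e //=; ring. Qed.

Lemma gE X Y : g X Y = x 1 X * x 1 Y + x 2 X * x 2 Y + x 3 X * x 3 Y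
  + x 4 X * x 4 Y + x 5 X * x 5 Y + x 6 X * x 6 Y.
Proof. by rewrite /g mxE sum6 !mxE. Qed.

Definition wedge3 (i j k : nat) X Y Z : K :=
  x i X * (x j Y * x k Z - x k Y * x j Z)
  - x j X * (x i Y * x k Z - x k Y * x i Z)
  + x k X * (x i Y * x j Z - x j Y * x i Z).

Definition wedge4 (i j k l : nat) X Y Z W : K :=
  x i X * wedge3 j k l Y Z W - x j X * wedge3 i k l Y Z W
  + x k X * wedge3 i j l Y Z W - x l X * wedge3 i j k Y Z W.

(* The scalars name the data: b = a_2, m = -(a + a_2)/2 is the diagonal entry of
   A, and (w3, w4), (l3, l4), (n3, n4) are the coordinates of v, alpha, nu. *)
Variables (m a b v1 v2 q c w3 w4 l3 l4 n3 n4 : K).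

(** The expansion of d^c omega in the basis e^{ijk}; the next definition is that of d omega. The
    entry q of A occurs in neither, because the skew part of A generates rotations of k_3 and these
    preserve e^{34}. *)
Definition dcomega3 X Y Z : K :=
    b * wedge3 1 2 5 X Y Z - c * wedge3 1 3 4 X Y Z - l4 * wedge3 1 3 5 X Y Z
  + n4 * wedge3 1 3 6 X Y Z + l3 * wedge3 1 4 5 X Y Z - n3 * wedge3 1 4 6 X Y Z
  - v1 * wedge3 1 5 6 X Y Z - (l3 + n4) * wedge3 2 3 5 X Y Z
  + (n3 - l4) * wedge3 2 4 5 X Y Z - v2 * wedge3 2 5 6 X Y Z
  - (a + b) * wedge3 3 4 5 X Y Z - w3 * wedge3 3 5 6 X Y Z
  - w4 * wedge3 4 5 6 X Y Z.

Definition domega3 X Y Z : K :=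
  - b * wedge3 1 2 6 X Y Z + (l4 - n3) * wedge3 1 3 6 X Y Z
  - (l3 + n4) * wedge3 1 4 6 X Y Z - v2 * wedge3 1 5 6 X Y Z
  + c * wedge3 2 3 4 X Y Z + n3 * wedge3 2 3 5 X Y Z
  + l3 * wedge3 2 3 6 X Y Z + n4 * wedge3 2 4 5 X Y Z
  + l4 * wedge3 2 4 6 X Y Z + v1 * wedge3 2 5 6 X Y Z
  + (a + b) * wedge3 3 4 6 X Y Z - w4 * wedge3 3 5 6 X Y Z
  + w3 * wedge3 4 5 6 X Y Z.

(* With p and p' the projections onto types (1,0) and (0,1), this is i times the
   (1,2) part minus the (2,1) part of f, so it maps d omega to d^c omega. *)
Definition type_diff (i : K) (p p' : 'cV[K]_6 -> 'cV[K]_6)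
    (f : 'cV[K]_6 -> 'cV[K]_6 -> 'cV[K]_6 -> K) X Y Z : K :=
  i * ((f (p X) (p' Y) (p' Z) + f (p' X) (p Y) (p' Z) + f (p' X) (p' Y) (p Z))
    - (f (p' X) (p Y) (p Z) + f (p X) (p' Y) (p Z) + f (p X) (p Y) (p' Z))).

(** Exchanging p and p' replaces i by -i, so in the difference only the terms with one or three
    factors j survive. They carry i or i^3, and the outer factor i makes their coefficients free of
    i. *)
Lemma type_diff_wedge3 (h i : K) (j p p' : 'cV[K]_6 -> 'cV[K]_6) k l n X Y Z :
  h * 2 = 1 -> i * i = -1 ->
  (forall U, p U = h *: (U - i *: j U)) ->
  (forall U, p' U = h *: (U + i *: j U)) ->
  type_diff i p p' (wedge3 k l n) X Y Z =
  - (h * h) * (wedge3 k l n (j X) Y Z + wedge3 k l n X (j Y) Z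
    + wedge3 k l n X Y (j Z) + 3 * wedge3 k l n (j X) (j Y) (j Z)).
Proof.
move=> h2 i2 pE p'E.
transitivity (h * h * (h * 2) * ((i * i) * (wedge3 k l n (j X) Y Z
    + wedge3 k l n X (j Y) Z + wedge3 k l n X Y (j Z))
  - 3 * ((i * i) * (i * i)) * wedge3 k l n (j X) (j Y) (j Z))).
  by rewrite /type_diff /wedge3 !pE !p'E !xE; ring.
by rewrite h2 i2; ring.
Qed.

Section TypeDifference.
Variables (h i : K) (p p' : 'cV[K]_6 -> 'cV[K]_6).
Hypotheses (h2 : h * 2 = 1) (i2 : i * i = -1).
Hypothesis pE : forall U, p U = h *: (U - i *: J U).
Hypothesis p'E : forall U, p' U = h *: (U + i *: J U).

Lemma type_diff_domega3 X Y Z : type_diff i p p' domega3 X Y Z = dcomega3 X Y Z.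
Proof.
(* By linearity it is enough to treat one basis 3-form at a time. *)
pose D k l n := type_diff i p p' (wedge3 k l n) X Y Z.
transitivity (- b * D 1 2 6 + (l4 - n3) * D 1 3 6
  - (l3 + n4) * D 1 4 6 - v2 * D 1 5 6
  + c * D 2 3 4 + n3 * D 2 3 5
  + l3 * D 2 3 6 + n4 * D 2 4 5
  + l4 * D 2 4 6 + v1 * D 2 5 6
  + (a + b) * D 3 4 6 - w4 * D 3 5 6
  + w3 * D 4 5 6).
  by rewrite /D /type_diff /domega3; ring.
(* [ring] does not know [h2], so the scalar 4 h^2 is kept visible until it is rewritten to 1. *)
transitivity (h * 2 * (h * 2) * dcomega3 X Y Z); last by rewrite h2 !mul1r.
rewrite /D !(type_diff_wedge3 _ _ _ _ _ _ h2 i2 pE p'E) /dcomega3 /wedge3 !xJ.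
by ring.
Qed.

End TypeDifference.

Variable br : 'cV[K]_6 -> 'cV[K]_6 -> 'cV[K]_6.
Hypothesis br1 : forall X Y, x 1 (br X Y) =
   - (c * (x 3 X * x 4 Y - x 3 Y * x 4 X)
      + ((n3 * x 3 X + n4 * x 4 X) * x 5 Y - (n3 * x 3 Y + n4 * x 4 Y) * x 5 X)
      + b * (x 2 X * x 5 Y - x 2 Y * x 5 X))
   + (x 6 X * (l3 * x 3 Y + l4 * x 4 Y + v1 * x 5 Y)
      - x 6 Y * (l3 * x 3 X + l4 * x 4 X + v1 * x 5 X)).
Hypothesis br2 : forall X Y, x 2 (br X Y) =
  x 6 X * (b * x 2 Y + (n3 - l4) * x 3 Y + (n4 + l3) * x 4 Y + v2 * x 5 Y)
  - x 6 Y * (b * x 2 X + (n3 - l4) * x 3 X + (n4 + l3) * x 4 X + v2 * x 5 X).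
Hypothesis br3 : forall X Y, x 3 (br X Y) =
  x 6 X * (m * x 3 Y + q * x 4 Y + w3 * x 5 Y)
  - x 6 Y * (m * x 3 X + q * x 4 X + w3 * x 5 X).
Hypothesis br4 : forall X Y, x 4 (br X Y) =
  x 6 X * (m * x 4 Y - q * x 3 Y + w4 * x 5 Y)
  - x 6 Y * (m * x 4 X - q * x 3 X + w4 * x 5 X).
Hypothesis br5 : forall X Y, x 5 (br X Y) =
  x 6 X * (a * x 5 Y) - x 6 Y * (a * x 5 X).
Hypothesis br6 : forall X Y, x 6 (br X Y) = 0.
(** The trace of B on n vanishes. This form replaces m = -(a + b)/2, which makes no sense in a ring
    where 2 need not be invertible. *)
Hypothesis am : a = - m - m - b.

Lemma domega3E X Y Z :
  - g (J (br X Y)) Z + g (J (br X Z)) Y - g (J (br Y Z)) X = domega3 X Y Z.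
Proof.
rewrite !gE !xJ !br1 !br2 !br3 !br4 !br5 !br6 am /domega3 /wedge3 am.
by ring.
Qed.

(** The left side is the differential of a 3-form written out on four vectors; the seven scalars on
    the right are the SKT equations. *)
Lemma d_dcomega3 X Y Z W :
  - dcomega3 (br X Y) Z W + dcomega3 (br X Z) Y W - dcomega3 (br X W) Y Z
  - dcomega3 (br Y Z) X W + dcomega3 (br Y W) X Z - dcomega3 (br Z W) X Y =
  b * (a + b) * wedge4 1 2 5 6 X Y Z W + c * (a + b) * wedge4 1 3 4 6 X Y Z W
  + (m * l4 + b * n3 - c * w4 - q * l3) * wedge4 1 3 5 6 X Y Z W
  + (- m * l3 + b * n4 + c * w3 - q * l4) * wedge4 1 4 5 6 X Y Z W
  + ((m - b) * (l3 + n4) - q * (n3 - l4)) * wedge4 2 3 5 6 X Y Z W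
  - ((m - b) * (n3 - l4) + q * (l3 + n4)) * wedge4 2 4 5 6 X Y Z W
  + (b * (a + b) - 2 * (c * v1) + 2 * (l3 * l3 + l4 * l4 + l3 * n4 - l4 * n3
      + n3 * n3 + n4 * n4)) * wedge4 3 4 5 6 X Y Z W.
Proof.
rewrite /dcomega3 /wedge4 /wedge3 !br1 !br2 !br3 !br4 !br5 !br6 am.
by ring.
Qed.

End Coordinates.

(** * Omitted indices, and sums over singletons and their complements *)

Lemma lift_lift0 n (i : 'I_n.+1) : lift (lift ord0 i) ord0 = ord0 :> 'I_n.+2.
Proof. exact: val_inj. Qed.

Lemma lift_liftS n (i : 'I_n.+1) (j : 'I_n) :
  lift (lift ord0 i) (lift ord0 j) = lift ord0 (lift i j).
Proof. by apply: val_inj; rewrite /= /bump; lia. Qed.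

Lemma sum_card1 (V : nmodType) (T : finType) (F : {set T} -> V) :
  \sum_(S : {set T} | #|S| == 1) F S = \sum_x F [set x].
Proof.
rewrite -(big_imset F (in2W set1_inj)) /=.
apply: eq_bigl => S; apply/cards1P/imsetP.
  by case=> i ->; exists i.
by case=> i _ ->; exists i.
Qed.

(** Complementation reduces this to singletons; it serves the (2,1) part of a 3-form. *)
Lemma sum_cardC1 (V : nmodType) (T : finType) n (F : {set T} -> V) :
  #|T| = n.+1 ->
  \sum_(S : {set T} | #|S| == n) F S = \sum_x F [set~ x].
Proof.
move=> nT; rewrite (reindex_inj (@setC_inj T)) /= -(sum_card1 (F \o @setC T)).
by apply: eq_bigl => S; have := cardsC S; rewrite nT; lia.
Qed.

(** * Differentials and type components in low degree *)

Section Forms.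
Variable R : realType.
Local Notation C := R[i].
Local Notation VC := 'cV[C]_6.
Variable br : 'cV[R]_6 -> 'cV[R]_6 -> 'cV[R]_6.
Local Notation brC := (complexify br).
Local Notation i0 := ord0.
Local Notation i1 := (lift ord0 ord0).
Local Notation i2 := (lift ord0 (lift ord0 ord0)).
Local Notation i3 := (lift ord0 (lift ord0 (lift ord0 ord0))).

Lemma vcons0 k X0 (X : 'I_k -> VC) : vcons X0 X ord0 = X0.
Proof. by rewrite /vcons unlift_none. Qed.

Lemma vconsS k X0 (X : 'I_k -> VC) m : vcons X0 X (lift ord0 m) = X m.
Proof. by rewrite /vcons liftK. Qed.

Definition CEdE := (vcons0, vconsS, lift_lift0, lift_liftS).

(** The curried [f] records that [s] depends only on the entries of the family, so families built
    with [vcons] and [lift] are handled without function extensionality. Indices are iterated lifts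
    of [ord0], the shape that [big_ord_recl] produces. *)
Lemma CEd2 (s : Defs.form R 2) (f : VC -> VC -> C) :
  (forall X, s X = f (X i0) (X i1)) -> forall X,
  CEd br s X = - f (brC (X i0) (X i1)) (X i2) + f (brC (X i0) (X i2)) (X i1)
    - f (brC (X i1) (X i2)) (X i0).
Proof.
move=> sE X; rewrite /CEd.
(* As a conditional inside the summand, i <= m is decided by computation once the sums are
   unrolled. *)
under eq_bigr => i _ do rewrite big_mkcond.
rewrite !big_ord_recl !big_ord0 /= !sE !CEdE /bump /=.
by ring.
Qed.

Lemma CEd3 (s : Defs.form R 3) (f : VC -> VC -> VC -> C) :
  (forall X, s X = f (X i0) (X i1) (X i2)) -> forall X,
  CEd br s X =
    - f (brC (X i0) (X i1)) (X i2) (X i3) + f (brC (X i0) (X i2)) (X i1) (X i3)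
    - f (brC (X i0) (X i3)) (X i1) (X i2) - f (brC (X i1) (X i2)) (X i0) (X i3)
    + f (brC (X i1) (X i3)) (X i0) (X i2) - f (brC (X i2) (X i3)) (X i0) (X i1).
Proof.
move=> sE X; rewrite /CEd.
under eq_bigr => i _ do rewrite big_mkcond.
rewrite !big_ord_recl !big_ord0 /= !sE !CEdE /bump /=.
by ring.
Qed.

Lemma type_part2E (s : Defs.form R 2) (f : VC -> VC -> C) :
  (forall X, s X = f (X i0) (X i1)) -> forall X,
  (type_part 0 s X = f (proj01 (X i0)) (proj01 (X i1))) *
  (type_part 1 s X = f (proj10 (X i0)) (proj01 (X i1))
                     + f (proj01 (X i0)) (proj10 (X i1))) *
  (type_part 2 s X = f (proj10 (X i0)) (proj10 (X i1))).
Proof.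
move=> sE X; rewrite /type_part; split; first split.
- by under eq_bigl do rewrite cards_eq0; rewrite big_pred1_eq sE !inE.
- by rewrite sum_card1 !big_ord_recl big_ord0 !sE !inE /= addr0.
- rewrite (big_pred1 setT) => [|S]; last first.
    have S2 : (#|S| <= 2)%N by rewrite -[leqRHS]card_ord max_card.
    by rewrite /= eqEcard subsetT cardsT card_ord eqn_leq S2.
  by rewrite sE !inE.
Qed.

Lemma type_part3E (s : Defs.form R 3) (f : VC -> VC -> VC -> C) :
  (forall X, s X = f (X i0) (X i1) (X i2)) -> forall X,
  (type_part 1 s X = f (proj10 (X i0)) (proj01 (X i1)) (proj01 (X i2))
                     + f (proj01 (X i0)) (proj10 (X i1)) (proj01 (X i2))
                     + f (proj01 (X i0)) (proj01 (X i1)) (proj10 (X i2))) *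
  (type_part 2 s X = f (proj01 (X i0)) (proj10 (X i1)) (proj10 (X i2))
                     + f (proj10 (X i0)) (proj01 (X i1)) (proj10 (X i2))
                     + f (proj10 (X i0)) (proj10 (X i1)) (proj01 (X i2))).
Proof.
move=> sE X; rewrite /type_part; split.
- by rewrite sum_card1 !big_ord_recl big_ord0 !sE !inE /= addr0 addrA.
- rewrite sum_cardC1 ?card_ord // !big_ord_recl big_ord0 !sE !inE /= addr0.
  by rewrite addrA.
Qed.

End Forms.

(** * Coordinates on the plane k_3 *)

Section Plane.
Variable K : comNzRingType.
Implicit Types (al : 'rV[K]_2) (w : 'cV[K]_2).

(** [J3] and [Amx] have width 1 + 1 read as 2, so the indices 0 and 1 match the two blocks only
    through their values. *)
Lemma row_mx2E n (u u' : 'cV[K]_n) i :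
  ((row_mx u u' : 'M_(n, 1 + 1)) i (0 : 'I_2) = u i 0) *
  ((row_mx u u' : 'M_(n, 1 + 1)) i (1 : 'I_2) = u' i 0).
Proof.
split; first by rewrite -(row_mxEl u u'); congr (row_mx u u' i _); exact: val_inj.
by rewrite -(row_mxEr u u'); congr (row_mx u u' i _); exact: val_inj.
Qed.

Lemma sum2 (V : nmodType) (F : 'I_2 -> V) : \sum_(i < 2) F i = F 0 + F 1.
Proof.
rewrite !big_ord_recl big_ord0 addr0.
by congr (_ + F _); apply: val_inj.
Qed.

Lemma mulmx2E n p (M : 'M[K]_(n, 2)) (N : 'M[K]_(2, p)) i j :
  (M *m N) i j = M i 0 * N 0 j + M i 1 * N 1 j.
Proof. by rewrite mxE sum2. Qed.

Lemma rV2P al al' : al 0 0 = al' 0 0 -> al 0 1 = al' 0 1 -> al = al'.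
Proof.
move=> e0 e1; apply/rowP => i.
by case: (unliftP 0 i) => [j|] ->; rewrite ?ord1 ?e0 //;
  rewrite (_ : lift _ _ = 1) //; apply: val_inj.
Qed.

Lemma cV2P w w' : w 0 0 = w' 0 0 -> w 1 0 = w' 1 0 -> w = w'.
Proof. by move=> e0 e1; apply/trmx_inj/rV2P; rewrite !mxE. Qed.

Lemma Jform0 al : Jform al 0 0 = - al 0 1.
Proof. by rewrite /Jform mxE mulmx2E /J3 !row_mx2E !mxE /=; ring. Qed.

Lemma Jform1 al : Jform al 0 1 = al 0 0.
Proof. by rewrite /Jform mxE mulmx2E /J3 !row_mx2E !mxE /=; ring. Qed.

End Plane.

(** * Coordinates of the real bracket *)

Section BracketCoordinates.
Variables (R : realType) (Xi : data R).
Local Notation a := (a_ Xi).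
Local Notation a2 := (a2_ Xi).
Local Notation q := (q_ Xi).
Local Notation m := (- (2^-1 * (a + a2))).

Lemma AmxE : (Amx Xi 0 0 = m) * (Amx Xi 0 1 = q) *
  (Amx Xi 1 0 = - q) * (Amx Xi 1 1 = m).
Proof. by repeat split; rewrite /Amx row_mx2E !mxE /=; ring. Qed.

Implicit Types X Y : 'cV[R]_6.

Lemma k3_projE X : (k3_proj X 0 0 = x 3 X) * (k3_proj X 1 0 = x 4 X).
Proof. by split; rewrite /k3_proj !mxE /=; ring. Qed.

Lemma BE X :
  (x 1 (B Xi X) = alpha_ Xi 0 0 * x 3 X + alpha_ Xi 0 1 * x 4 X + v1_ Xi * x 5 X) *
  (x 2 (B Xi X) = a2 * x 2 X + (nu_ Xi 0 0 - alpha_ Xi 0 1) * x 3 X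
     + (nu_ Xi 0 1 + alpha_ Xi 0 0) * x 4 X + v2_ Xi * x 5 X) *
  (x 3 (B Xi X) = m * x 3 X + q * x 4 X + v_ Xi 0 0 * x 5 X) *
  (x 4 (B Xi X) = m * x 4 X - q * x 3 X + v_ Xi 1 0 * x 5 X) *
  (x 5 (B Xi X) = a * x 5 X) *
  (x 6 (B Xi X) = 0).
Proof.
repeat split; rewrite /B /ev !xE !x_e // !mulmx2E !k3_projE !AmxE;
  rewrite ?[(_ + nu_ Xi) _ _]mxE ?Jform0 ?Jform1 /=; ring.
Qed.

Lemma etaE X Y : Defs.eta Xi X Y = c_ Xi * (x 3 X * x 4 Y - x 3 Y * x 4 X)
  + ((nu_ Xi 0 0 * x 3 X + nu_ Xi 0 1 * x 4 X) * x 5 Y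
     - (nu_ Xi 0 0 * x 3 Y + nu_ Xi 0 1 * x 4 Y) * x 5 X)
  + a2 * (x 2 X * x 5 Y - x 2 Y * x 5 X).
Proof. by rewrite /Defs.eta /wedge /ev !mulmx2E !k3_projE. Qed.

Lemma x1_bracket X Y : x 1 (bracket Xi X Y) =
  - Defs.eta Xi X Y + (x 6 X * x 1 (B Xi Y) - x 6 Y * x 1 (B Xi X)).
Proof. by rewrite /bracket !xE x_e // mulr1. Qed.

Lemma x_bracket k X Y : (1 < k <= 6)%N ->
  x k (bracket Xi X Y) = x 6 X * x k (B Xi Y) - x 6 Y * x k (B Xi X).
Proof.
case: k => [//|[//|k]] /= k6.
by rewrite /bracket !xE x_e // mulr0 add0r.
Qed.

End BracketCoordinates.

(** * Complex bilinear extension of coordinate formulas *)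

Section Complexification.
Variable R : realType.
Local Notation C := R[i].
Local Notation "r %:C" := (r%:C)%C.
Implicit Types (Z W : 'cV[C]_6) (r : R).

(** Together with its bilinear analogue, this relation is closed under the operations below, so the
    extension of a coordinate formula is found by following its syntax. *)
Definition lin_ext (f : 'cV[R]_6 -> R) (F : 'cV[C]_6 -> C) :=
  forall Z, \sum_(i < 6) Z i 0 * (f (delta_mx i 0))%:C = F Z.

Definition bilin_ext (f : 'cV[R]_6 -> 'cV[R]_6 -> R)
    (F : 'cV[C]_6 -> 'cV[C]_6 -> C) :=
  forall Z W, \sum_(i < 6) \sum_(j < 6)
    Z i 0 * W j 0 * (f (delta_mx i 0) (delta_mx j 0))%:C = F Z W.

Lemma lin_ext_x k : lin_ext (x k) (x k).
Proof.
move=> Z; rewrite (bigD1 (inord k.-1)) //= big1 => [|i /negPf ik].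
  by rewrite /x mxE !eqxx mulr1 addr0.
by rewrite /x mxE eq_sym ik mulr0.
Qed.

Lemma lin_extD f F f' F' : lin_ext f F -> lin_ext f' F' ->
  lin_ext (fun X => f X + f' X) (fun Z => F Z + F' Z).
Proof.
move=> fF fF' Z; rewrite -fF -fF' -big_split; apply: eq_bigr => i _ /=.
by rewrite rmorphD mulrDr.
Qed.

Lemma lin_extN f F : lin_ext f F -> lin_ext (fun X => - f X) (fun Z => - F Z).
Proof.
move=> fF Z; rewrite -fF -sumrN; apply: eq_bigr => i _ /=.
by rewrite rmorphN mulrN.
Qed.

Lemma lin_extZ r f F : lin_ext f F ->
  lin_ext (fun X => r * f X) (fun Z => r%:C * F Z).
Proof.
move=> fF Z; rewrite -fF mulr_sumr; apply: eq_bigr => i _ /=.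
by rewrite rmorphM mulrCA.
Qed.

Lemma bilin_extM f F g G : lin_ext f F -> lin_ext g G ->
  bilin_ext (fun X Y => f X * g Y) (fun Z W => F Z * G W).
Proof.
move=> fF gG Z W; rewrite -fF -gG mulr_suml; apply: eq_bigr => i _.
by rewrite mulr_sumr; apply: eq_bigr => j _; rewrite rmorphM mulrACA.
Qed.

Lemma bilin_ext_sym f F : bilin_ext f F ->
  bilin_ext (fun X Y => f Y X) (fun Z W => F W Z).
Proof.
move=> fF Z W; rewrite -fF exchange_big; apply: eq_bigr => i _ /=.
by apply: eq_bigr => j _; rewrite [Z _ _ * _]mulrC.
Qed.

Lemma bilin_extD f F f' F' : bilin_ext f F -> bilin_ext f' F' ->
  bilin_ext (fun X Y => f X Y + f' X Y) (fun Z W => F Z W + F' Z W).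
Proof.
move=> fF fF' Z W; rewrite -fF -fF' -big_split; apply: eq_bigr => i _ /=.
by rewrite -big_split; apply: eq_bigr => j _; rewrite /= rmorphD mulrDr.
Qed.

Lemma bilin_extN f F : bilin_ext f F ->
  bilin_ext (fun X Y => - f X Y) (fun Z W => - F Z W).
Proof.
move=> fF Z W; rewrite -fF -sumrN; apply: eq_bigr => i _ /=.
by rewrite -sumrN; apply: eq_bigr => j _; rewrite rmorphN mulrN.
Qed.

Lemma bilin_extZ r f F : bilin_ext f F ->
  bilin_ext (fun X Y => r * f X Y) (fun Z W => r%:C * F Z W).
Proof.
move=> fF Z W; rewrite -fF mulr_sumr; apply: eq_bigr => i _ /=.
by rewrite mulr_sumr; apply: eq_bigr => j _; rewrite rmorphM mulrCA.
Qed.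

Lemma x_complexify br k f F :
  (forall X Y, x k (br X Y) = f X Y) -> bilin_ext f F ->
  forall Z W, x k (complexify br Z W) = F Z W.
Proof.
move=> brE fF Z W; rewrite -fF /complexify x_sum; apply: eq_bigr => i _.
by rewrite x_sum; apply: eq_bigr => j _; rewrite -brE xZ /x mxE.
Qed.

End Complexification.

(** Symmetry is tried last and only together with the product rule, since alone it would apply
    forever. *)
Ltac extend_bilin :=
  repeat first [exact: lin_ext_x | apply: lin_extZ | apply: lin_extD
    | apply: lin_extN | apply: bilin_extZ | apply: bilin_extD
    | apply: bilin_extN | apply: bilin_extM
    | refine (bilin_ext_sym (bilin_extM _ _))].

(** * Coordinates of the complexified bracket *)

Section ComplexBracket.
Variables (R : realType) (Xi : data R).
Local Notation "r %:C" := (r%:C)%C.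
Implicit Types Z W : 'cV[R[i]]_6.
Local Notation br := (complexify (bracket Xi)).
Local Notation a := (a_ Xi)%:C.
Local Notation b := (a2_ Xi)%:C.
Local Notation q := (q_ Xi)%:C.
Local Notation c := (c_ Xi)%:C.
Local Notation v1 := (v1_ Xi)%:C.
Local Notation v2 := (v2_ Xi)%:C.
Local Notation w3 := (v_ Xi 0 0)%:C.
Local Notation w4 := (v_ Xi 1 0)%:C.
Local Notation l3 := (alpha_ Xi 0 0)%:C.
Local Notation l4 := (alpha_ Xi 0 1)%:C.
Local Notation n3 := (nu_ Xi 0 0)%:C.
Local Notation n4 := (nu_ Xi 0 1)%:C.
Local Notation m := (- (2^-1 * (a_ Xi + a2_ Xi)))%:C.

Lemma x1_complexify X Y : x 1 (br X Y) =
   - (c * (x 3 X * x 4 Y - x 3 Y * x 4 X)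
      + ((n3 * x 3 X + n4 * x 4 X) * x 5 Y - (n3 * x 3 Y + n4 * x 4 Y) * x 5 X)
      + b * (x 2 X * x 5 Y - x 2 Y * x 5 X))
   + (x 6 X * (l3 * x 3 Y + l4 * x 4 Y + v1 * x 5 Y)
      - x 6 Y * (l3 * x 3 X + l4 * x 4 X + v1 * x 5 X)).
Proof.
move: X Y; apply: x_complexify => [X Y|].
  by rewrite x1_bracket !BE etaE.
by extend_bilin.
Qed.

Lemma x2_complexify X Y : x 2 (br X Y) =
  x 6 X * (b * x 2 Y + (n3 - l4) * x 3 Y + (n4 + l3) * x 4 Y + v2 * x 5 Y)
  - x 6 Y * (b * x 2 X + (n3 - l4) * x 3 X + (n4 + l3) * x 4 X + v2 * x 5 X).
Proof.
(* Each coefficient has to be a single embedded real for [bilin_extZ] to apply. *)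
rewrite -rmorphB -rmorphD; move: X Y; apply: x_complexify => [X Y|].
  by rewrite (@x_bracket _ _ 2 _ _ isT) !BE.
by extend_bilin.
Qed.

Lemma x3_complexify X Y : x 3 (br X Y) =
  x 6 X * (m * x 3 Y + q * x 4 Y + w3 * x 5 Y)
  - x 6 Y * (m * x 3 X + q * x 4 X + w3 * x 5 X).
Proof.
move: X Y; apply: x_complexify => [X Y|].
  by rewrite (@x_bracket _ _ 3 _ _ isT) !BE.
by extend_bilin.
Qed.

Lemma x4_complexify X Y : x 4 (br X Y) =
  x 6 X * (m * x 4 Y - q * x 3 Y + w4 * x 5 Y)
  - x 6 Y * (m * x 4 X - q * x 3 X + w4 * x 5 X).
Proof.
move: X Y; apply: x_complexify => [X Y|].
  by rewrite (@x_bracket _ _ 4 _ _ isT) !BE.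
by extend_bilin.
Qed.

Lemma x5_complexify X Y : x 5 (br X Y) =
  x 6 X * (a * x 5 Y) - x 6 Y * (a * x 5 X).
Proof.
move: X Y; apply: x_complexify => [X Y|].
  by rewrite (@x_bracket _ _ 5 _ _ isT) !BE.
by extend_bilin.
Qed.

Lemma x6_complexify X Y : x 6 (br X Y) = 0.
Proof.
(* The constant 0 is not among the shapes known to [extend_bilin]; a difference of null multiples of
   a product is. *)
rewrite -[RHS](subrr (0%:C * (x 6 X * x 6 Y))); move: X Y.
apply: x_complexify => [X Y|].
  by rewrite (@x_bracket _ _ 6 _ _ isT) !BE !mulr0 -(mul0r (x 6 X * x 6 Y)).
by extend_bilin.
Qed.

End ComplexBracket.

(** * The fundamental form has type (1,1) *)

Section OmegaType.
Variable K : comNzRingType.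
Variables (h i : K) (p p' : 'cV[K]_6 -> 'cV[K]_6).
Hypotheses (h2 : h * 2 = 1) (i2 : i * i = -1).
Hypothesis pE : forall U, p U = h *: (U - i *: J U).
Hypothesis p'E : forall U, p' U = h *: (U + i *: J U).

Lemma x_p k U : x k (p U) = h * (x k U - i * x k (J U)).
Proof. by rewrite pE xZ xD xN xZ. Qed.

Lemma x_p' k U : x k (p' U) = h * (x k U + i * x k (J U)).
Proof. by rewrite p'E xZ xD xZ. Qed.

(** J acts on vectors of type (0,1) by -i and preserves the bilinear g, so g vanishes on pairs of
    such vectors. Type (1,0) is alike, with i for -i. *)
Lemma omega02 X Y : g (J (p' X)) (p' Y) = 0.
Proof. by rewrite gE !xJ !x_p' !xJ; ring: i2. Qed.

Lemma omega20 X Y : g (J (p X)) (p Y) = 0.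
Proof. by rewrite gE !xJ !x_p !xJ; ring: i2. Qed.

Lemma omega11 X Y : g (J (p X)) (p' Y) + g (J (p' X)) (p Y) = g (J X) Y.
Proof.
transitivity (h * 2 * (h * 2) * g (J X) Y); last by rewrite h2 !mul1r.
by rewrite !gE !xJ !x_p !x_p' !xJ; ring: i2.
Qed.

End OmegaType.

(** Evaluation on four suitable basis vectors isolates each coefficient. *)
Lemma wedge4_free (K : comNzRingType) (t1 t2 t3 t4 t5 t6 t7 : K) :
  (forall X Y Z W, t1 * wedge4 1 2 5 6 X Y Z W + t2 * wedge4 1 3 4 6 X Y Z W
    + t3 * wedge4 1 3 5 6 X Y Z W + t4 * wedge4 1 4 5 6 X Y Z W
    + t5 * wedge4 2 3 5 6 X Y Z W - t6 * wedge4 2 4 5 6 X Y Z W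
    + t7 * wedge4 3 4 5 6 X Y Z W = 0) ->
  [/\ t1 = 0, t2 = 0, t3 = 0 /\ t4 = 0, t5 = 0 /\ t6 = 0 & t7 = 0].
Proof.
move=> t0; rewrite /wedge4 /wedge3 in t0.
have t1256 := t0 (e K 1) (e K 2) (e K 5) (e K 6).
have t1346 := t0 (e K 1) (e K 3) (e K 4) (e K 6).
have t1356 := t0 (e K 1) (e K 3) (e K 5) (e K 6).
have t1456 := t0 (e K 1) (e K 4) (e K 5) (e K 6).
have t2356 := t0 (e K 2) (e K 3) (e K 5) (e K 6).
(* The swap of e_4 and e_5 cancels the sign of t6. *)
have t2456 := t0 (e K 2) (e K 5) (e K 4) (e K 6).
have t3456 := t0 (e K 3) (e K 4) (e K 5) (e K 6).
clear t0; split; [rewrite -t1256|rewrite -t1346|split|split|rewrite -t3456].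
all: try by rewrite !x_e //=; ring.
- by rewrite -t1356 !x_e //=; ring.
- by rewrite -t1456 !x_e //=; ring.
- by rewrite -t2356 !x_e //=; ring.
- by rewrite -t2456 !x_e //=; ring.
Qed.

(** * The SKT condition as seven real equations *)

Section DolbeaultOmega.
Variables (R : realType) (Xi : data R).
Local Notation C := R[i].
Local Notation VC := 'cV[C]_6.
Local Notation "r %:C" := (r%:C)%C.
Local Notation br := (bracket Xi).
Local Notation a := (a_ Xi).
Local Notation b := (a2_ Xi).
Local Notation c := (c_ Xi).
Local Notation q := (q_ Xi).
Local Notation v1 := (v1_ Xi).
Local Notation v2 := (v2_ Xi).
Local Notation w3 := (v_ Xi 0 0).
Local Notation w4 := (v_ Xi 1 0).
Local Notation l3 := (alpha_ Xi 0 0).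
Local Notation l4 := (alpha_ Xi 0 1).
Local Notation n3 := (nu_ Xi 0 0).
Local Notation n4 := (nu_ Xi 0 1).
Local Notation m := (- (2^-1 * (a + b))).
Local Notation T := (domega3 a%:C b%:C v1%:C v2%:C c%:C w3%:C w4%:C l3%:C l4%:C
  n3%:C n4%:C).
Local Notation H := (dcomega3 a%:C b%:C v1%:C v2%:C c%:C w3%:C w4%:C l3%:C l4%:C
  n3%:C n4%:C).
Local Notation i0 := ord0.
Local Notation i1 := (lift ord0 ord0).
Local Notation i2 := (lift ord0 (lift ord0 ord0)).
Local Notation i3 := (lift ord0 (lift ord0 (lift ord0 ord0))).

Lemma half_C : 2^-1 * 2 = 1 :> C.
Proof. by rewrite mulVf // pnatr_eq0. Qed.

Lemma sqr_iC : 'i%C * 'i%C = -1 :> C.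
Proof. by rewrite -expr2 sqr_i. Qed.

Lemma a_eq_m_b : a%:C = - m%:C - m%:C - b%:C.
Proof. by rewrite -!rmorphN -!rmorphD; congr (_%:C); lra. Qed.

Lemma ord01 : (1 : 'I_2) = i1.
Proof. exact: val_inj. Qed.

Lemma omegaE (X : 'I_2 -> VC) : @omega R X = g (J (X i0)) (X i1).
Proof. by rewrite /omega ord01. Qed.

Lemma CEd_omega (X : 'I_3 -> VC) : CEd br (@omega R) X = T (X i0) (X i1) (X i2).
Proof.
rewrite (CEd2 br (f := fun U W => g (J U) W) omegaE).
exact: (domega3E (x1_complexify Xi) (x2_complexify Xi) (x3_complexify Xi)
  (x4_complexify Xi) (x5_complexify Xi) (x6_complexify Xi) a_eq_m_b).
Qed.

Lemma type_part_omega (X : 'I_2 -> VC) :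
  (type_part 0 (@omega R) X = 0) * (type_part 1 (@omega R) X = @omega R X) *
  (type_part 2 (@omega R) X = 0).
Proof.
pose tE := type_part2E (f := fun U W => g (J U) W) omegaE X.
split; first split.
- exact: etrans (tE.1.1) (omega02 sqr_iC (fun _ => erefl) _ _).
- rewrite omegaE; apply: etrans (tE.1.2) _.
  exact: (omega11 half_C sqr_iC (fun _ => erefl) (fun _ => erefl)).
- exact: etrans (tE.2) (omega20 sqr_iC (fun _ => erefl) _ _).
Qed.

Lemma dc_omega (X : 'I_3 -> VC) :
  dc br (@omega R) X = H (X i0) (X i1) (X i2).
Proof.
(* The sums defining [del] and [delbar] run over p = 0, 1, 2. This removes p = 0 and p = 2, where
   the part of omega vanishes pointwise. *)
have d0 n (Y : 'I_3 -> VC) (s : Defs.form R 2) : (forall Z, s Z = 0) ->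
    type_part n (CEd br s) Y = 0 :> C.
  move=> s0; rewrite /type_part big1 // => S _.
  by rewrite (CEd2 br (f := fun _ _ => 0) s0) !oppr0 !addr0.
have dT (Y : 'I_3 -> VC) : CEd br (type_part 1 (@omega R)) Y =
    T (Y i0) (Y i1) (Y i2).
  rewrite -CEd_omega (CEd2 br (f := fun U W => g (J U) W)) => [|Z].
    by rewrite (CEd2 br (f := fun U W => g (J U) W) omegaE).
  by rewrite type_part_omega omegaE.
rewrite /dc /delbar /del !big_ord_recl !big_ord0 /= /bump /=.
rewrite !(d0 _ _ _ (fun Z => (type_part_omega Z).1.1)).
rewrite !(d0 _ _ _ (fun Z => (type_part_omega Z).2)).
rewrite !add0r !addr0 !(type_part3E dT).
exact: (type_diff_domega3 _ _ _ _ _ _ _ _ _ _ _ half_C sqr_iC (p := @proj10 R)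
  (p' := @proj01 R) (fun _ => erefl) (fun _ => erefl)).
Qed.

(** The two inner pairs are the components of one equation each on k_3: the first determines c v,
    the second is linear in rho = nu + J alpha. *)
Definition ddc_coeffs : Prop :=
  [/\ b * (a + b) = 0, c * (a + b) = 0,
      (m * l4 + b * n3 - c * w4 - q * l3 = 0)
      /\ (- m * l3 + b * n4 + c * w3 - q * l4 = 0),
      ((m - b) * (l3 + n4) - q * (n3 - l4) = 0)
      /\ ((m - b) * (n3 - l4) + q * (l3 + n4) = 0)
    & b * (a + b) - 2 * (c * v1) + 2 * (l3 * l3 + l4 * l4 + l3 * n4 - l4 * n3
      + n3 * n3 + n4 * n4) = 0].

Lemma ddc_omega (X : 'I_4 -> VC) :
  CEd br (dc br (@omega R)) X =
    (b * (a + b))%:C * wedge4 1 2 5 6 (X i0) (X i1) (X i2) (X i3)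
  + (c * (a + b))%:C * wedge4 1 3 4 6 (X i0) (X i1) (X i2) (X i3)
  + (m * l4 + b * n3 - c * w4 - q * l3)%:C
    * wedge4 1 3 5 6 (X i0) (X i1) (X i2) (X i3)
  + (- m * l3 + b * n4 + c * w3 - q * l4)%:C
    * wedge4 1 4 5 6 (X i0) (X i1) (X i2) (X i3)
  + ((m - b) * (l3 + n4) - q * (n3 - l4))%:C
    * wedge4 2 3 5 6 (X i0) (X i1) (X i2) (X i3)
  - ((m - b) * (n3 - l4) + q * (l3 + n4))%:C
    * wedge4 2 4 5 6 (X i0) (X i1) (X i2) (X i3)
  + (b * (a + b) - 2 * (c * v1) + 2 * (l3 * l3 + l4 * l4 + l3 * n4 - l4 * n3
      + n3 * n3 + n4 * n4))%:C * wedge4 3 4 5 6 (X i0) (X i1) (X i2) (X i3).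
Proof.
rewrite (CEd3 br (f := H) dc_omega).
rewrite (d_dcomega3 (x1_complexify Xi) (x2_complexify Xi) (x3_complexify Xi)
  (x4_complexify Xi) (x5_complexify Xi) (x6_complexify Xi) a_eq_m_b).
congr (_ * _ + _ * _ + _ * _ + _ * _ + _ * _ - _ * _ + _ * _);
  by rewrite !(rmorphD, rmorphB, rmorphN, rmorphM, rmorph_nat) /=.
Qed.

Lemma SKT_coeffs : SKT br <-> ddc_coeffs.
Proof.
split=> [skt|[e1 e2 [e3 e4] [e5 e6] e7] X]; last first.
  by rewrite ddc_omega e7 e6 e5 e4 e3 e2 e1 rmorph0 !mul0r subr0 !addr0.
(* Four vectors are turned into a family by [nth], whose values at the indices reduce to them. The
   coefficients are embedded reals, so [complexI] then returns to R. *)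
have [] := @wedge4_free C _ _ _ _ _ _ _ (fun X Y Z W => etrans
  (esym (ddc_omega (fun l : 'I_4 => nth 0 [:: X; Y; Z; W] l))) (skt _)).
by rewrite /ddc_coeffs => /complexI ? /complexI ? [/complexI ? /complexI ?]
  [/complexI ? /complexI ?] /complexI ?.
Qed.

End DolbeaultOmega.

(** * Consequences of admissibility *)

Section Admissible.
Variables (R : realType) (Xi : data R).
Hypothesis adm : admissible Xi.
Local Notation a := (a_ Xi).
Local Notation b := (a2_ Xi).
Local Notation c := (c_ Xi).
Local Notation q := (q_ Xi).
Local Notation l3 := (alpha_ Xi 0 0).
Local Notation l4 := (alpha_ Xi 0 1).
Local Notation n3 := (nu_ Xi 0 0).
Local Notation n4 := (nu_ Xi 0 1).

Lemma eta_coeff_neq0 : c = 0 -> n3 = 0 -> n4 = 0 -> b != 0.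
Proof.
move=> c0 n30 n40; case: (eta_neq0 adm) => X [Y [_ _]]; apply: contra => /eqP b0.
by rewrite etaE c0 n30 n40 b0; apply/eqP; ring.
Qed.

(** A^* multiplies e^{34} by the trace of A, which is -(a + a_2). *)
Lemma c_trace0 : c * (a + b) = 0.
Proof.
have := jacobi2 adm (E3 R) (E4 R).
rewrite /pull2 /e34 !mulmx2E !AmxE !mxE /= => j2.
by lra.
Qed.

Lemma vec6_eq0 (X : 'cV[R]_6) : x 1 X = 0 -> x 2 X = 0 -> x 3 X = 0 ->
  x 4 X = 0 -> x 5 X = 0 -> x 6 X = 0 -> X = 0.
Proof.
move=> x1 x2 x3 x4 x5 x6; apply/colP => i; rewrite mxE -(inord_val i).
by case: i => [[|[|[|[|[|[|]]]]]]].
Qed.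

Lemma not_all_a_a2_q_eq0 : ~ [/\ a = 0, b = 0 & q = 0].
Proof.
case=> a0 b0 q0; apply: (B_not_nilpotent adm); exists 3 => X _ /=.
(* Here B sends e_5 into <e_1, e_2> + k_3, then k_3 into <e_1, e_2>, and kills e_1 and e_2; hence
   B^3 = 0. *)
by apply: vec6_eq0; rewrite !BE ?a0 ?b0 ?q0; ring.
Qed.

Lemma SKT_nu : SKT (bracket Xi) -> n3 = l4 /\ n4 = - l3.
Proof.
move=> /SKT_coeffs [e1 e2 _ [e5 e6] _].
set t := - (2^-1 * (a + b)) - b in e5 e6.
(* [e5] and [e6] are the real and imaginary parts of (t + iq)((l3 + n4) + i(n3 - l4)) = 0.
   Multiplication by t - iq gives [r3] and [r4]. *)
have r3 : (t ^+ 2 + q ^+ 2) * (n3 - l4) = 0.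
  by transitivity (t * (t * (n3 - l4) + q * (l3 + n4))
    - q * (t * (l3 + n4) - q * (n3 - l4))); [ring | rewrite e5 e6; ring].
have r4 : (t ^+ 2 + q ^+ 2) * (l3 + n4) = 0.
  by transitivity (t * (t * (l3 + n4) - q * (n3 - l4))
    + q * (t * (n3 - l4) + q * (l3 + n4))); [ring | rewrite e5 e6; ring].
have [|tq] := eqVneq (t ^+ 2 + q ^+ 2) 0.
  move=> /eqP; rewrite paddr_eq0 ?sqr_ge0 // !sqrf_eq0 => /andP[/eqP t0 /eqP q0].
  have b0 : b = 0.
    (* t = 0 means a + b = -2b, so b (a + b) = 0 reads -2 b^2 = 0. *)
    have : b ^+ 2 = 0 by rewrite /t in t0; nra.
    by move/eqP; rewrite sqrf_eq0 => /eqP.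
  by case: not_all_a_a2_q_eq0; split=> //; rewrite /t b0 in t0; lra.
move: r3 r4 => /eqP; rewrite mulf_eq0 (negPf tq) => /eqP r3 /eqP.
rewrite mulf_eq0 (negPf tq) => /eqP r4; split; lra.
Qed.

End Admissible.

(** * The two families of solutions *)

Theorem proposition4p13 (R : realType) (a a2 v1 v2 q c : R)
    (v : 'cV[R]_2) (alpha nu : 'rV[R]_2) :
  let Xi := Data a a2 v1 v2 q c v alpha nu in
  admissible Xi ->
  (SKT (bracket Xi) <->
    ([/\ a2 = - a,
         c != 0,
         v1 = c^-1 * normsq alpha,
         v = - c^-1 *: (((Amx Xi)^T + a%:M) *m sharp alpha)
       & nu = - Jform alpha]
     \/
     [/\ a2 = - a, - a != 0, c = 0, alpha = 0 & nu = 0])).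
Proof.
move=> Xi adm.
have normsqE : normsq alpha = alpha 0 0 ^+ 2 + alpha 0 1 ^+ 2.
  by rewrite /normsq mulmx2E !mxE !expr2.
(* The diagonal entry of A^t + a Id is a - (a + a_2)/2 = (a - a_2)/2. *)
have vE : let w := - c^-1 *: (((Amx Xi)^T + a%:M) *m sharp alpha) in
  w 0 0 = - c^-1 * ((2^-1 * (a - a2)) * alpha 0 0 - q * alpha 0 1) /\
  w 1 0 = - c^-1 * ((2^-1 * (a - a2)) * alpha 0 1 + q * alpha 0 0).
  have AtE i j : ((Amx Xi)^T + a%:M) i j = Amx Xi j i + a *+ (i == j).
    by rewrite mxE [X in X + _]mxE [X in _ + X]mxE.
  have scaleE (w : 'cV[R]_2) i : (- c^-1 *: w) i 0 = - c^-1 * w i 0.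
    by rewrite mxE.
  rewrite /= !scaleE !mulmx2E !AtE !AmxE /sharp ![alpha^T _ _]mxE /=.
  by split; congr (_ * _); field.
split=> [skt|].
  have [n3 n4] := SKT_nu adm skt.
  have cs := c_trace0 adm.
  have nuE : nu = - Jform alpha.
    by apply: rV2P; rewrite mxE ?Jform0 ?Jform1 ?opprK.
  move/SKT_coeffs: skt => [e1 _ [e3 e4] _ e7]; rewrite /= in e1 e3 e4 e7 n3 n4 cs.
  (* With nu = -J alpha the quadratic part of [e7] collapses to |alpha|^2, and [e7] says c v_1 =
     |alpha|^2. *)
  rewrite n3 n4 e1 in e3 e4 e7.
  have [c0|c0] := eqVneq c 0; [right|left].
    have : alpha 0 0 ^+ 2 + alpha 0 1 ^+ 2 = 0 by rewrite c0 in e7; lra.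
    move=> /eqP; rewrite paddr_eq0 ?sqr_ge0 // !sqrf_eq0 => /andP[/eqP l3 /eqP l4].
    (* Since c, alpha and nu vanish, only a_2 e^{25} is left of the nonzero form eta. *)
    have a2n0 : a2 != 0.
      by apply: (eta_coeff_neq0 adm) => //=; rewrite ?n3 ?n4 ?l3 ?l4 ?oppr0.
    have alpha0 : alpha = 0 by apply: rV2P; rewrite mxE.
    have a2E : a2 = - a.
      by move/eqP: e1; rewrite mulf_eq0 (negPf a2n0) /= addrC addr_eq0 => /eqP.
    split=> //; first by rewrite -a2E.
    by rewrite nuE alpha0 /Jform mul0mx !oppr0.
  have a2E : a2 = - a.
    by move/eqP: cs; rewrite mulf_eq0 (negPf c0) /= addrC addr_eq0 => /eqP.
  rewrite a2E in e3 e4.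
  split=> //.
    by apply: (mulfI c0); rewrite normsqE mulVKf //; lra.
  have [w0 w1] := vE; apply: cV2P; rewrite ?w0 ?w1 a2E; apply: (mulfI c0);
    rewrite mulrA mulrN mulfV //; lra.
case=> [[a2E c0 v1E vE' nuE] | [a2E a0 c0 alpha0 nu0]].
  have n3 : nu 0 0 = alpha 0 1 by rewrite nuE mxE Jform0 opprK.
  have n4 : nu 0 1 = - alpha 0 0 by rewrite nuE mxE Jform1.
  have [] := vE; rewrite -vE' => w0 w1.
  apply/SKT_coeffs; rewrite /ddc_coeffs /= n3 n4 w0 w1 v1E normsqE a2E.
  split; [by field|by field|split; by field|split; by field|by field].
apply/SKT_coeffs; rewrite /ddc_coeffs /= c0 alpha0 nu0 !mxE a2E.
by split; [ring|ring|split; ring|split; ring|ring].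
Qed.
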